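(* Let $c_1>c_2>0$, $c_3>0$, $c_+=\sqrt{(c_1^2+c_2^2)/2}$, $c_+<v<c_1$ (the supersonic range) and $Q_*>0$. Consider continuously differentiable $u,w:\mathbb R\to\mathbb R$ with $$(c_1^2-v^2)u''(\eta)-c_3^2\big(u(\eta)-w(\eta)\big)=0,\qquad (c_2^2-v^2)w''(\eta)+c_3^2\big(u(\eta)-w(\eta)\big)=0\qquad(\eta>0),$$ $$u''(\eta)=w''(\eta)=0\qquad(\eta<0),$$ such that $u(\eta)\to0$, $w(\eta)\to0$ as $\eta\to+\infty$ and $w(0)-u(0)=Q_*$. Then $$u(\eta)=-B(v^2-c_2^2)e^{-\nu\eta},\qquad w(\eta)=-B(c_1^2-v^2)e^{-\nu\eta}\qquad(\eta>0),$$ $$u(\eta)=-B(v^2-c_2^2)(1-\nu\eta),\qquad w(\eta)=-B(c_1^2-v^2)(1-\nu\eta)\qquad(\eta<0),$$ where $$B=\frac{Q_*}{2v^2-c_1^2-c_2^2},\qquad \nu=c_3\sqrt{\frac{c_1^2+c_2^2-2v^2}{(c_1^2-v^2)(c_2^2-v^2)}}>0.$$ The tensile forces $\mathcal P_1=c_1^2u'(\eta)$ and $\mathbb P_2=c_2^2w'(\eta)$ at $\eta<0$ are $$\mathcal P_1=\frac{c_3c_1^2Q_*}{\sqrt{2v^2-c_1^2-c_2^2}}\sqrt{\frac{v^2-c_2^2}{c_1^2-v^2}},\qquad \mathbb P_2=c_2^2\nu B(c_1^2-v^2)=\frac{c_2^2(c_1^2-v^2)}{c_1^2(v^2-c_2^2)}\,\mathcal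 P_1<\mathcal P_1.$$
   Context: The model: two elastic strings with displacements $u$ (wave speed $c_1$) and $w$ (wave speed $c_2$), connected for $\eta=x-vt>0$ by distributed bonds of stiffness $c_3^2$ and separated for $\eta<0$; $v$ is the splitting speed and $Q_*$ the critical bond strain, reached at $\eta=0$. In the supersonic range the disturbance induced from the left vanishes as $\eta\to+\infty$. *)

(* Defs.v *)
From Stdlib Require Import Reals.
From Coquelicot Require Import Coquelicot.

Open Scope R_scope.

(** Two elastic strings with wave speeds [c1] and [c2], connected for
    [eta = x - v t > 0] by distributed bonds of stiffness [c3 ^ 2] and
    separated for [eta < 0]; [v] is the splitting speed and [Q] the critical
    bond strain, reached at [eta = 0]. *)

Definition c_plus (c1 c2 : R) : R := sqrt ((c1 ^ 2 + c2 ^ 2) / 2).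

Definition C1_on_R (f : R -> R) : Prop :=
  (forall x : R, ex_derive f x) /\ (forall x : R, continuous (Derive f) x).

(** Since [Derive_n] is total, twice differentiability away from [0] has to be
    required separately; nothing is assumed about second derivatives at [0]. *)
Record splitting_wave (c1 c2 c3 v Q : R) (u w : R -> R) : Prop := {
  wave_C1_u : C1_on_R u;
  wave_C1_w : C1_on_R w;
  wave_ex2_u : forall eta : R, eta <> 0 -> ex_derive_n u 2 eta;
  wave_ex2_w : forall eta : R, eta <> 0 -> ex_derive_n w 2 eta;
  wave_bonded_u : forall eta : R, 0 < eta ->
    (c1 ^ 2 - v ^ 2) * Derive_n u 2 eta - c3 ^ 2 * (u eta - w eta) = 0;
  wave_bonded_w : forall eta : R, 0 < eta ->
    (c2 ^ 2 - v ^ 2) * Derive_n w 2 eta + c3 ^ 2 * (u eta - w eta) = 0;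
  wave_free_u : forall eta : R, eta < 0 -> Derive_n u 2 eta = 0;
  wave_free_w : forall eta : R, eta < 0 -> Derive_n w 2 eta = 0;
  wave_lim_u : is_lim u p_infty 0;
  wave_lim_w : is_lim w p_infty 0;
  wave_split : w 0 - u 0 = Q
}.

Definition amplitude (c1 c2 v Q : R) : R := Q / (2 * v ^ 2 - c1 ^ 2 - c2 ^ 2).

Definition decay_rate (c1 c2 c3 v : R) : R :=
  c3 * sqrt ((c1 ^ 2 + c2 ^ 2 - 2 * v ^ 2)
             / ((c1 ^ 2 - v ^ 2) * (c2 ^ 2 - v ^ 2))).

Definition tensile_force (c : R) (f : R -> R) (eta : R) : R :=
  c ^ 2 * Derive f eta.

(* Main.v *)
Require Import Defs.
From Stdlib Require Import Reals Lra.
From Coquelicot Require Import Coquelicot.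

Open Scope R_scope.

(** The combination [(c1^2 - v^2) u + (c2^2 - v^2) w] has zero second derivative
    on the bonded side, so it is affine there and, tending to [0], vanishes.
    This decouples the system: [u] and [w] both solve [f'' = nu^2 f]. For such
    [f] the quantity [(f' + nu f) exp (- nu x)] is a first integral, and decay
    forces it to be [0], so that [f' = - nu f] down to [x = 0]. On the separated
    side the solution is affine, with the value and slope at [0] inherited by
    continuity. *)

(** * Functions with vanishing first or second derivative *)

Lemma eq_of_derive_zero_between (f : R -> R) (a b : R) :
  (forall x, continuous f x) ->
  (forall x, Rmin a b < x < Rmax a b -> is_derive f x 0) ->
  f b = f a.
Proof.
intros Hc Hd.
destruct (MVT_gen f a b (fun _ => 0)) as [c [_ Hc']].
- exact Hd.
- intros x _. apply continuity_pt_filterlim. apply Hc.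
- lra.
Qed.

(** The derivative of [g] is controlled only strictly between [0] and [x], because nothing is known
    about second derivatives of the wave at [0]; continuity carries the conclusion to the endpoints.
    [Rmin] and [Rmax] allow both signs of [x], hence both the bonded and the separated side. *)
Lemma affine_of_second_derive_zero (f g : R -> R) (x : R) :
  (forall y, is_derive f y (g y)) ->
  (forall y, continuous g y) ->
  (forall y, Rmin 0 x < y < Rmax 0 x -> is_derive g y 0) ->
  g x = g 0 /\ f x = f 0 + g 0 * x.
Proof.
intros Hf Hg Hg'.
assert (Hconst : forall y, Rmin 0 x <= y <= Rmax 0 x -> g y = g 0).
{ intros y Hy. apply eq_of_derive_zero_between; [exact Hg|].
  intros z Hz. apply Hg'. revert Hy Hz.
  unfold Rmin, Rmax; repeat destruct Rle_dec; lra. }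
split.
- apply Hconst. split; [apply Rmin_r | apply Rmax_r].
- assert (H : f x - g 0 * x = f 0 - g 0 * 0); [|lra].
  assert (Hd : forall y, is_derive (fun t => f t - g 0 * t) y (g y - g 0)).
  { intros y. apply (is_derive_minus f (fun t => g 0 * t)); [apply Hf|].
    auto_derive; [exact I | ring]. }
  apply (eq_of_derive_zero_between (fun t => f t - g 0 * t)).
  + intros y. apply (ex_derive_continuous (fun t => f t - g 0 * t)).
    eexists; apply Hd.
  + intros y Hy. assert (Hy0 := Hd y).
    rewrite (Hconst y), Rminus_diag in Hy0 by lra. exact Hy0.
Qed.

(** Dividing by [x] isolates the slope: [f x / x] tends to [q] and also to [0]. After that [f] is
    the constant [p] on the right, and its limit gives [p = 0]. *)
Lemma affine_vanishing_at_infinity (f : R -> R) (p q : R) :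
  (forall x, 0 < x -> f x = p + q * x) -> is_lim f p_infty 0 ->
  p = 0 /\ q = 0.
Proof.
intros Hf Hl.
assert (Hinv : is_lim (fun x => / x) p_infty 0).
{ apply (is_lim_inv (fun x => x) p_infty p_infty); [apply is_lim_id | easy]. }
assert (Hpos : Rbar_locally' p_infty (fun x => 0 < x)) by (exists 0; auto).
assert (Hq : q = 0).
{ assert (H0 : is_lim (fun x => f x * / x) p_infty (0 * 0)).
  { apply (is_lim_mult f (fun x => / x) p_infty 0 0); easy. }
  assert (H1 : is_lim (fun x => f x * / x) p_infty (p * 0 + q)).
  { apply (is_lim_ext_loc (fun x => p * / x + q)).
    - revert Hpos; apply filter_imp. intros x Hx. rewrite Hf by easy. field; lra.
    - apply is_lim_plus'; [|apply is_lim_const].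
      apply (is_lim_scal_l (fun x => / x) p p_infty 0); easy. }
  apply is_lim_unique in H0. apply is_lim_unique in H1. rewrite H1 in H0.
  injection H0; lra. }
split; [|exact Hq].
assert (H1 : is_lim f p_infty p).
{ apply (is_lim_ext_loc (fun _ => p)); [|apply is_lim_const].
  revert Hpos; apply filter_imp. intros x Hx. rewrite Hf by easy. rewrite Hq; ring. }
apply is_lim_unique in H1. apply is_lim_unique in Hl. rewrite Hl in H1.
injection H1; auto.
Qed.

(** * Decaying solutions of [f'' = k ^ 2 f] on the half-line *)

Lemma is_lim_exp_neg (k : R) : 0 < k -> is_lim (fun x => exp (- k * x)) p_infty 0.
Proof.
intros Hk.
apply (is_lim_comp exp (fun x => - k * x) p_infty 0 m_infty).
- apply is_lim_exp_m.
- replace m_infty with (Rbar_mult (- k) p_infty).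
  + apply is_lim_scal_l, is_lim_id.
  + unfold Rbar_mult, Rbar_mult'; destruct Rle_dec; [exfalso; lra | reflexivity].
- exists 0; easy.
Qed.

(** Integrating the first integral [C] once more gives [f x = C / (2 * k) * exp (k * x) + D * exp (-
    k * x)]. Decay excludes the growing mode, and [C = 0] is exactly the slope condition at [0]. *)
Lemma decaying_solution (f g : R -> R) (k : R) :
  0 < k ->
  (forall x, is_derive f x (g x)) ->
  (forall x, continuous g x) ->
  (forall x, 0 < x -> is_derive g x (k ^ 2 * f x)) ->
  is_lim f p_infty 0 ->
  g 0 = - k * f 0 /\ forall x, 0 <= x -> f x = f 0 * exp (- k * x).
Proof.
intros Hk Hf Hg Hg' Hl.
assert (Hfc : forall x, continuous f x).
{ intros x. apply (ex_derive_continuous f). eexists; apply Hf. }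
assert (Hexp : forall m x, is_derive (fun t => exp (m * t)) x (m * exp (m * x))).
{ intros m x. auto_derive; [exact I | ring]. }
assert (Hexpc : forall m x, continuous (fun t => exp (m * t)) x).
{ intros m x. apply (ex_derive_continuous (fun t => exp (m * t))). eexists; apply Hexp. }
assert (Hprod : forall x, exp (k * x) * exp (- k * x) = 1).
{ intros x. rewrite <- exp_plus. replace (k * x + - k * x) with 0 by ring. apply exp_0. }
set (C := g 0 + k * f 0).
assert (HC : forall x, 0 <= x -> (g x + k * f x) * exp (- k * x) = C).
{ intros x Hx.
  transitivity ((g 0 + k * f 0) * exp (- k * 0));
    [|rewrite Rmult_0_r, exp_0; unfold C; ring].
  apply (eq_of_derive_zero_between (fun t => (g t + k * f t) * exp (- k * t))).
  - intros y. apply (continuous_mult (fun t => g t + k * f t)); [|apply Hexpc].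
    apply (continuous_plus g (fun t => k * f t)); [apply Hg|].
    apply (continuous_scal_r k f), Hfc.
  - intros y Hy. rewrite Rmin_left, Rmax_right in Hy by lra.
    replace 0 with ((k ^ 2 * f y + k * g y) * exp (- k * y)
                    + (g y + k * f y) * (- k * exp (- k * y))) by ring.
    apply (is_derive_mult (fun t => g t + k * f t) (fun t => exp (- k * t)));
      [|apply Hexp|intros; apply Rmult_comm].
    apply (is_derive_plus g (fun t => k * f t)); [apply Hg'; lra|].
    apply is_derive_scal, Hf. }
set (D := f 0 - C / (2 * k)).
assert (HD : forall x, 0 <= x ->
  f x * exp (k * x) = C / (2 * k) * exp (2 * k * x) + D).
{ intros x Hx.
  assert (H : f x * exp (k * x) - C / (2 * k) * exp (2 * k * x)
              = f 0 * exp (k * 0) - C / (2 * k) * exp (2 * k * 0)).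
  2: { rewrite !Rmult_0_r, exp_0 in H. unfold D. lra. }
  assert (Hd : forall y, is_derive
     (fun t => f t * exp (k * t) - C / (2 * k) * exp (2 * k * t)) y
     ((g y * exp (k * y) + f y * (k * exp (k * y)))
       - C / (2 * k) * (2 * k * exp (2 * k * y)))).
  { intros y.
    apply (is_derive_minus (fun t => f t * exp (k * t))
             (fun t => C / (2 * k) * exp (2 * k * t))).
    - apply (is_derive_mult f (fun t => exp (k * t)));
        [apply Hf | apply Hexp | intros; apply Rmult_comm].
    - apply is_derive_scal, Hexp. }
  apply (eq_of_derive_zero_between
    (fun t => f t * exp (k * t) - C / (2 * k) * exp (2 * k * t))).
  - intros y. apply (ex_derive_continuous
      (fun t => f t * exp (k * t) - C / (2 * k) * exp (2 * k * t))).
    eexists; apply Hd.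
  - intros y Hy. rewrite Rmin_left, Rmax_right in Hy by lra.
    match goal with |- is_derive _ _ ?z => replace z with
      ((g y * exp (k * y) + f y * (k * exp (k * y)))
       - C / (2 * k) * (2 * k * exp (2 * k * y))) end; [apply Hd|].
    (* By [HC], [C * exp (2 * k * y)] equals [(g y + k * f y) * exp (k * y)], which is the
       derivative of [f t * exp (k * t)] at [y]; the two contributions cancel. *)
    replace (2 * k * y) with (k * y + k * y) by ring.
    rewrite exp_plus, <- (HC y) by lra.
    replace ((g y + k * f y) * exp (- k * y) / (2 * k)
             * (2 * k * (exp (k * y) * exp (k * y))))
      with ((g y + k * f y) * exp (k * y) * (exp (k * y) * exp (- k * y)))
      by (field; lra).
    rewrite Hprod. ring. }
(* Multiplication by [exp (- k * x)] turns the growing mode into the constant [C / (2 * k)], while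
   the product of [f] with this factor tends to [0]. *)
assert (HC0 : C = 0).
{ assert (H0 : is_lim (fun x => f x * exp (- k * x)) p_infty (0 * 0)).
  { apply (is_lim_mult f (fun x => exp (- k * x)) p_infty 0 0);
      [exact Hl | apply is_lim_exp_neg; lra | easy]. }
  assert (H1 : is_lim (fun x => f x * exp (- k * x)) p_infty (C / (2 * k) + D * 0)).
  { apply (is_lim_ext_loc (fun x => C / (2 * k) + D * exp (- (2 * k) * x))).
    - exists 0. intros x Hx.
      replace (- (2 * k) * x) with (- k * x + - k * x) by ring.
      specialize (HD x (Rlt_le _ _ Hx)).
      replace (2 * k * x) with (k * x + k * x) in HD by ring.
      rewrite exp_plus in HD |- *.
      assert (HP := Hprod x).
      set (E := exp (k * x)) in *; set (F := exp (- k * x)) in *.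
      transitivity ((f x * E) * F * F);
        [rewrite HD | transitivity (f x * F * (E * F)); [ring | rewrite HP; ring]].
      transitivity (C / (2 * k) * (E * F) * (E * F) + D * (F * F));
        [rewrite HP; ring | ring].
    - apply is_lim_plus'; [apply is_lim_const|].
      apply (is_lim_scal_l (fun x => exp (- (2 * k) * x)) D p_infty 0).
      apply is_lim_exp_neg; lra. }
  apply is_lim_unique in H0. apply is_lim_unique in H1. rewrite H1 in H0.
  injection H0. intros H.
  replace C with (2 * k * (C / (2 * k))) by (field; lra).
  replace (C / (2 * k)) with 0 by lra. ring. }
split; [unfold C in HC0; lra|].
intros x Hx. specialize (HD x Hx). unfold D in HD.
rewrite HC0 in HD. replace (0 / (2 * k)) with 0 in HD by (field; lra).
transitivity (f x * exp (k * x) * exp (- k * x)).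
- rewrite Rmult_assoc, Hprod; ring.
- rewrite HD; ring.
Qed.

(** * The coupled strings in the supersonic range *)

Theorem mainTheorem4 (c1 c2 c3 v Q : R) (u w : R -> R)
    (hc2 : 0 < c2) (hc12 : c2 < c1) (hc3 : 0 < c3)
    (hv_lo : c_plus c1 c2 < v) (hv_hi : v < c1) (hQ : 0 < Q)
    (huw : splitting_wave c1 c2 c3 v Q u w) :
  let B := amplitude c1 c2 v Q in
  let nu := decay_rate c1 c2 c3 v in
  0 < nu /\
  (forall eta : R, 0 < eta ->
     u eta = - B * (v ^ 2 - c2 ^ 2) * exp (- nu * eta) /\
     w eta = - B * (c1 ^ 2 - v ^ 2) * exp (- nu * eta)) /\
  (forall eta : R, eta < 0 ->
     u eta = - B * (v ^ 2 - c2 ^ 2) * (1 - nu * eta) /\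
     w eta = - B * (c1 ^ 2 - v ^ 2) * (1 - nu * eta)) /\
  (forall eta : R, eta < 0 ->
     let P1 := tensile_force c1 u eta in
     let P2 := tensile_force c2 w eta in
     P1 = c3 * c1 ^ 2 * Q / sqrt (2 * v ^ 2 - c1 ^ 2 - c2 ^ 2)
          * sqrt ((v ^ 2 - c2 ^ 2) / (c1 ^ 2 - v ^ 2)) /\
     P2 = c2 ^ 2 * nu * B * (c1 ^ 2 - v ^ 2) /\
     P2 = c2 ^ 2 * (c1 ^ 2 - v ^ 2) / (c1 ^ 2 * (v ^ 2 - c2 ^ 2)) * P1 /\
     P2 < P1).
Proof.
destruct huw as [[Hu Huc] [Hw Hwc] Hu2 Hw2 Hbu Hbw Hfu Hfw Hlu Hlw Hs].
assert (Hdu : forall x, is_derive u x (Derive u x)) by (intro; apply Derive_correct, Hu).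
assert (Hdw : forall x, is_derive w x (Derive w x)) by (intro; apply Derive_correct, Hw).
assert (Hdu2 : forall x, x <> 0 -> is_derive (Derive u) x (Derive_n u 2 x))
  by (intros x Hx; apply Derive_correct, (Hu2 x Hx)).
assert (Hdw2 : forall x, x <> 0 -> is_derive (Derive w) x (Derive_n w 2 x))
  by (intros x Hx; apply Derive_correct, (Hw2 x Hx)).
(* The supersonic range becomes [0 < a < b]: [v < c1] gives [0 < a], and [c_plus c1 c2 < v] gives
   [a < b], since [b - a = 2 * v ^ 2 - c1 ^ 2 - c2 ^ 2]. *)
set (a := c1 ^ 2 - v ^ 2) in *.
set (b := v ^ 2 - c2 ^ 2) in *.
assert (Hvpos : 0 < v).
{ apply Rle_lt_trans with (2 := hv_lo). apply sqrt_pos. }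
assert (Ha : 0 < a) by (unfold a; nra).
assert (Hab : a < b).
{ assert (H : c_plus c1 c2 ^ 2 < v ^ 2).
  { assert (0 <= c_plus c1 c2) by apply sqrt_pos. nra. }
  unfold c_plus in H. rewrite pow2_sqrt in H by nra. unfold a, b; lra. }
replace (c2 ^ 2 - v ^ 2) with (- b) in * by (unfold b; ring).
intros B nu.
assert (HB : B = Q / (b - a)).
{ unfold B, amplitude. f_equal. unfold a, b; ring. }
assert (Hquot : 0 < (b - a) / (a * b)) by (apply Rdiv_lt_0_compat; nra).
(* Numerator and denominator of the radicand are both negative; the signs cancel. *)
assert (Hnu : nu = c3 * sqrt ((b - a) / (a * b))).
{ unfold nu, decay_rate. f_equal. f_equal. fold a.
  replace (c2 ^ 2 - v ^ 2) with (- b) by (unfold b; ring).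
  replace (c1 ^ 2 + c2 ^ 2 - 2 * v ^ 2) with (- (b - a)) by (unfold a, b; ring).
  field; lra. }
assert (Hnu2 : nu ^ 2 = c3 ^ 2 * ((b - a) / (a * b))).
{ rewrite Hnu, Rpow_mult_distr, pow2_sqrt by lra. reflexivity. }
assert (Hnupos : 0 < nu).
{ rewrite Hnu. apply Rmult_lt_0_compat; [lra | apply sqrt_lt_R0; lra]. }
assert (HBpos : 0 < B) by (rewrite HB; apply Rdiv_lt_0_compat; lra).
clearbody nu B.
(* Adding the two bonded equations eliminates the coupling term and leaves [l'' = 0]. *)
set (l := fun x => a * u x - b * w x).
assert (Hl : forall x, 0 < x -> l x = l 0 + (a * Derive u 0 - b * Derive w 0) * x).
{ intros x Hx.
  apply (affine_of_second_derive_zero l (fun y => a * Derive u y - b * Derive w y) x).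
  - intros y. apply (is_derive_minus (fun y => a * u y) (fun y => b * w y));
      apply is_derive_scal; auto.
  - intros y. apply (continuous_minus (fun y => a * Derive u y) (fun y => b * Derive w y)).
    + apply (continuous_scal_r a (Derive u)), Huc.
    + apply (continuous_scal_r b (Derive w)), Hwc.
  - intros y Hy. rewrite Rmin_left, Rmax_right in Hy by lra.
    replace 0 with (a * Derive_n u 2 y - b * Derive_n w 2 y)
      by (specialize (Hbu y); specialize (Hbw y); lra).
    apply (is_derive_minus (fun y => a * Derive u y) (fun y => b * Derive w y));
      apply is_derive_scal; [apply Hdu2 | apply Hdw2]; lra. }
assert (Hll : is_lim l p_infty 0).
{ replace 0 with (a * 0 - b * 0) by ring.
  apply is_lim_minus'.
  - apply (is_lim_scal_l u a p_infty 0), Hlu.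
  - apply (is_lim_scal_l w b p_infty 0), Hlw. }
destruct (affine_vanishing_at_infinity l _ _ Hl Hll) as [Hl0 Hl0'].
assert (Hl_eq : forall x, 0 < x -> a * u x = b * w x).
{ intros x Hx. specialize (Hl x Hx). rewrite Hl0, Hl0' in Hl. unfold l in Hl. lra. }
unfold l in Hl0.
(* The values at [0] solve the linear system [a * u 0 = b * w 0], [w 0 - u 0 = Q], whose determinant
   is [b - a] up to sign. *)
assert (Hu0 : u 0 = - B * b).
{ rewrite HB. apply (Rmult_eq_reg_r (b - a)); [|lra].
  transitivity (- Q * b); [|field; lra]. rewrite <- Hs; nra. }
assert (Hw0 : w 0 = - B * a).
{ rewrite HB. apply (Rmult_eq_reg_r (b - a)); [|lra].
  transitivity (- Q * a); [|field; lra]. rewrite <- Hs; nra. }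
destruct (decaying_solution u (Derive u) nu) as [Hu0' Hue]; auto.
(* Substituting [w = a * u / b] turns [c3 ^ 2 * (u - w) / a] into [nu ^ 2 * u]. *)
{ intros x Hx. replace (nu ^ 2 * u x) with (Derive_n u 2 x); [apply Hdu2; lra|].
  apply (Rmult_eq_reg_l a); [|lra].
  transitivity (c3 ^ 2 * (u x - w x)); [specialize (Hbu x Hx); lra|].
  replace (w x) with (a * u x / b) by (rewrite Hl_eq by easy; field; lra).
  rewrite Hnu2; field; lra. }
destruct (decaying_solution w (Derive w) nu) as [Hw0' Hwe]; auto.
{ intros x Hx. replace (nu ^ 2 * w x) with (Derive_n w 2 x); [apply Hdw2; lra|].
  apply (Rmult_eq_reg_l b); [|lra].
  transitivity (c3 ^ 2 * (u x - w x)); [specialize (Hbw x Hx); lra|].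
  replace (u x) with (b * w x / a) by (rewrite <- Hl_eq by easy; field; lra).
  rewrite Hnu2; field; lra. }
(* The slope at [0] is the one already found from the bonded side, since [Derive u] is continuous
   across [0]. *)
assert (Hfree_u : forall x, x < 0 ->
  Derive u x = Derive u 0 /\ u x = u 0 + Derive u 0 * x).
{ intros x Hx. apply (affine_of_second_derive_zero u (Derive u)); auto.
  intros y Hy. rewrite Rmin_right, Rmax_left in Hy by lra.
  rewrite <- (Hfu y) by lra. apply Hdu2; lra. }
assert (Hfree_w : forall x, x < 0 ->
  Derive w x = Derive w 0 /\ w x = w 0 + Derive w 0 * x).
{ intros x Hx. apply (affine_of_second_derive_zero w (Derive w)); auto.
  intros y Hy. rewrite Rmin_right, Rmax_left in Hy by lra.
  rewrite <- (Hfw y) by lra. apply Hdw2; lra. }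
split; [exact Hnupos|].
split; [|split].
- intros x Hx. split.
  + rewrite Hue, Hu0 by lra. reflexivity.
  + rewrite Hwe, Hw0 by lra. reflexivity.
- intros x Hx. split.
  + rewrite (proj2 (Hfree_u x Hx)), Hu0', Hu0. ring.
  + rewrite (proj2 (Hfree_w x Hx)), Hw0', Hw0. ring.
- intros x Hx. cbv zeta. unfold tensile_force.
  rewrite (proj1 (Hfree_u x Hx)), (proj1 (Hfree_w x Hx)), Hu0', Hw0', Hu0, Hw0.
  split; [|split; [|split]].
  + replace (2 * v ^ 2 - c1 ^ 2 - c2 ^ 2) with (b - a) by (unfold a, b; ring).
    rewrite Hnu, HB.
    (* Write everything in terms of the roots of [a], [b], [b - a] so that [field] applies. *)
    rewrite !sqrt_div, sqrt_mult by nra.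
    assert (Hsa := sqrt_lt_R0 a Ha).
    assert (Hsb := sqrt_lt_R0 b ltac:(lra)).
    assert (Hss := sqrt_lt_R0 (b - a) ltac:(lra)).
    assert (Hb2 : b = sqrt b ^ 2) by (rewrite pow2_sqrt; lra).
    assert (Hs2 : b - a = sqrt (b - a) ^ 2) by (rewrite pow2_sqrt; lra).
    set (sa := sqrt a) in *; set (sb := sqrt b) in *; set (s := sqrt (b - a)) in *.
    rewrite Hs2, Hb2. field; lra.
  + ring.
  + field; lra.
  (* The difference of the forces is [nu * B * (c1 ^ 2 * b - c2 ^ 2 * a)], positive because
     [c1 ^ 2 > c2 ^ 2 > 0] and [b > a > 0]. *)
  + apply Rlt_0_minus.
    replace (_ - _) with (nu * B * (c1 ^ 2 * b - c2 ^ 2 * a)) by ring.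
    apply Rmult_lt_0_compat; [nra|].
    assert (c2 ^ 2 < c1 ^ 2) by nra.
    assert (0 < c2 ^ 2) by nra. nra.
Qed.
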